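(* Let $Y$ be a real valued random variable such that its quantile function $H_Y$ is convex on $(0,1)$ and such that for some $(p,T)\in(1,\infty)\times[1,\infty)$ and all $\delta,x,y\in(0,1)$, \[ \left\vert H_Y^*(\delta x)-H_Y^*(\delta y)\right\vert\leq T\delta^{-1/p}\left\vert H_Y^*(x)-H_Y^*(y)\right\vert. \] Let $R>1$ be such that $T\leq (R-1)R^{-1/p}/2$. Then for all $x\in(0,1)$, \[ H_Y^*(x/R)\geq\frac{1}{x}\int_0^xH_Y^*(u)\,du. \]
   Context: For a real valued random variable $Y$ with cumulative distribution function $F_Y(t)=\mathbb{P}\{Y\leq t\}$, the quantile function $H_Y:(0,1)\to\mathbb{R}$ is defined by $H_Y(s)=\inf\{t\in\mathbb{R}:F_Y(t)\geq s\}$, and $H_Y^*:(0,1)\to\mathbb{R}$ is defined by $H_Y^*(x)=H_Y(1-x)$. *)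

(* Defs.v *)
From HB Require Import structures.
From mathcomp Require Import all_boot all_order all_algebra.
From mathcomp Require Import all_classical all_reals all_analysis.

Set Implicit Arguments.
Unset Strict Implicit.
Unset Printing Implicit Defensive.

Import Order.TTheory GRing.Theory Num.Theory.
Import numFieldNormedType.Exports.

Local Open Scope classical_set_scope.
Local Open Scope ring_scope.

(* Total on R, but meaningful only for 0 < s < 1: there the set is nonempty and
   bounded below, so that the real [inf] is the true infimum. *)
Definition quantile d (T : measurableType d) (R : realType)
    (P : probability T R) (Y : {RV P >-> R}) (s : R) : R :=
  inf [set t : R | (s%:E <= cdf Y t)%E].

Definition quantile_star d (T : measurableType d) (R : realType)
    (P : probability T R) (Y : {RV P >-> R}) (x : R) : R :=
  quantile Y (1 - x).

(* Main.v *)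
Require Import Defs.
From HB Require Import structures.
From mathcomp Require Import all_boot all_order all_algebra.
From mathcomp Require Import all_classical all_reals all_analysis.
From mathcomp Require Import measurable_realfun ring lra.

Set Implicit Arguments.
Unset Strict Implicit.
Unset Printing Implicit Defensive.

Import Order.TTheory GRing.Theory Num.Theory.
Import numFieldNormedType.Exports.

Local Open Scope classical_set_scope.
Local Open Scope ring_scope.

(** Write G for the star quantile, q = 1/r and h_n = G(x q^n) - G(x).
    Convexity bounds the integral of G - G(x) over [x q^(n+1), x q^n) by the
    trapezoid rule, so the mean of G - G(x) over (0, x) is at most
    S = sum_n q^n (1-q) (h_n + h_(n+1))/2.
    The scaling hypothesis with delta = q gives h_(n+1) <= h_1 + K h_n with
    K = T r^(1/p), hence, shifting the index by one,
    S <= (1-q)/2 h_1 + q h_1 + K q S.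
    The assumption on T reads K q <= (1-q)/2, so the bound S <= h_1, that is
    G(x/r) - G(x), is reproduced by the recursion on the partial sums. *)

(** The set of [u] with [t <= cdf Y u] lies inside the one for [s]. The limits of [cdf Y] at both
    infinities, with [t < 1] and [0 < s], make the smaller set nonempty and the larger one bounded
    below, so neither infimum falls back on a default value. *)
Lemma quantile_nondecreasing (R : realType) (d : measure_display)
    (Omega : measurableType d) (P : probability Omega R) (Y : {RV P >-> R})
    (s t : R) :
  0 < s -> s <= t -> t < 1 -> quantile Y s <= quantile Y t.
Proof.
move=> s_gt0 st t_lt1; apply: lb_le_inf.
- apply: contrapT => no_t.
  have : (1 <= t%:E)%E.
    apply: (cvge_le _ (cvg_cdfy1 Y)); apply: nearW => u.
    by rewrite leNgt; apply/negP => /ltW tu; apply: no_t; exists u.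
  by rewrite lee_fin leNgt t_lt1.
- move=> u /= tu; apply: ge_inf; last by rewrite /= (le_trans _ tu)// lee_fin.
  apply: contrapT => no_lb.
  have : (s%:E <= 0)%E.
    apply: (cvge_ge _ (cvg_cdfNy0 Y)); apply: nearW => v.
    rewrite leNgt; apply/negP => vs; apply: no_lb; exists v => w /= sw.
    rewrite leNgt; apply/negP => /ltW /(cdf_nondecreasing Y) wv.
    by have := le_lt_trans (le_trans sw wv) vs; rewrite ltxx.
  by rewrite lee_fin leNgt s_gt0.
Qed.

(** For [- f], which is nondecreasing on [i], the preimage in [i] of each ray [[r, +oo[] is an
    interval, and these rays generate the Borel sets. *)
Lemma nonincreasing_in_itv_measurable (R : realType) (i : interval R)
    (f : R -> R) :
  {in i &, {homo f : u v /~ u <= v}} -> measurable_fun [set` i] f.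
Proof.
move=> f_ni; rewrite -(opprK f); apply/measurable_funN.
apply: (measurability (@RGenCInfty.G R)) => [|/= _ [_] [r] -> <-].
  exact: RGenCInfty.measurableE.
apply: is_interval_measurable => s t [/= si].
rewrite in_itv/= andbT => fs [/= ti ft] u /andP[su ut].
have ui : u \in i by apply: (interval_is_interval si ti); rewrite su.
by split; rewrite //= in_itv/= andbT (le_trans fs)// lerN2 f_ni.
Qed.

Lemma integral_affine (R : realType) (a b c m : R) : a < b ->
  (\int[lebesgue_measure]_(u in `[a, b]) (c + m * (u - a))%:E
   = ((b - a) * (c + m * (b - a) / 2))%:E)%E.
Proof.
move=> ab.
pose F (u : R) : R := c * u + m * (u - a) ^+ 2 / 2.
have dF u : is_derive u (1:R) F (c + m * (u - a)).
  by rewrite /F; apply: is_derive_eq; rewrite /GRing.scale/=; field.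
rewrite (@continuous_FTC2 R (fun u => c + m * (u - a)) F a b ab).
- by rewrite -EFinB /F; congr (_%:E); field.
- apply: continuous_subspaceT => u.
  by apply: cvgD; [exact: cvg_cst|apply: cvgMr; apply: cvgB; [exact: cvg_id|exact: cvg_cst]].
- have cF u : {for u, continuous F}.
    by apply: differentiable_continuous; apply/derivable1_diffP; exact: ex_derive.
  split => [u _| |]; first exact: ex_derive.
  + by apply: cvg_at_right_filter; exact: cF.
  + by apply: cvg_at_left_filter; exact: cF.
- by move=> u _; rewrite derive1E; exact: derive_val.
Qed.

Lemma convex_function_chord (R : realType) (D : set R) (f : R -> R) (a b u : R) :
  convex_function D (f : R -> R) -> D a -> D b -> a < b -> a <= u <= b ->
  f u <= f a + (f b - f a) / (b - a) * (u - a).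
Proof.
move=> f_cvx Da Db ab /andP[au ub].
have ba : 0 < b - a by rewrite subr_gt0.
have t_ge0 : 0 <= (b - u) / (b - a) by rewrite divr_ge0 ?subr_ge0// ltW.
have t_le1 : (b - u) / (b - a) <= 1 by rewrite ler_pdivrMr// mul1r lerB.
set t := (b - u) / (b - a) in t_ge0 t_le1.
have : f (t * a + (1 - t) * b) <= t * f a + (1 - t) * f b.
  by apply: (f_cvx (Itv01 t_ge0 t_le1) a b); rewrite inE.
have -> : t * a + (1 - t) * b = u by rewrite /t; field; rewrite gt_eqF.
move=> /le_trans; apply; rewrite le_eqVlt; apply/predU1P; left.
by rewrite /t; field; rewrite gt_eqF.
Qed.

Lemma geometric_trapezoid_sum_le (R : realType) (q K : R) (h : nat -> R) :
  0 < q < 1 -> 0 <= K -> K * q <= (1 - q) / 2 -> h 0%N = 0 -> 0 <= h 1%N ->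
  (forall n, h n.+1 <= h 1%N + K * h n) ->
  forall N, \sum_(n < N) q ^+ n * (1 - q) * ((h n + h n.+1) / 2) <= h 1%N.
Proof.
move=> /andP[q0 q1] K0 Kq h0 h1 hK; elim=> [|N IH]; first by rewrite big_ord0.
(* The first term is split off, not the last: it equals [(1 - q) / 2 * h 1], and the shifted
   remainder is compared with the sum of length [N] that [IH] bounds. *)
rewrite big_ord_recl expr0 mul1r h0 add0r.
have -> : h (@ord0 N).+1 = h 1%N by [].
have E : \sum_(n < N) q ^+ n * (1 - q) = 1 - q ^+ N.
  by rewrite -mulr_suml mulrC -(opprB q) mulNr -subrX1 opprB.
have : \sum_(i < N) q ^+ (lift ord0 i) * (1 - q) * ((h (lift ord0 i) + h (lift ord0 i).+1) / 2)
  <= \sum_(n < N) (q * h 1%N * (q ^+ n * (1 - q)) + K * q * (q ^+ n * (1 - q) * ((h n + h n.+1) / 2))).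
  apply: ler_sum => i _; rewrite /= /bump /= add1n exprS.
  have A := hK i; have B := hK i.+1.
  have C : 0 <= q * q ^+ i * (1 - q) by rewrite !mulr_ge0 ?exprn_ge0 ?subr_ge0 ?ltW.
  (* The recursion [hK] at [i] and at [i.+1], averaged. *)
  have D : (h i.+1 + h i.+2) / 2 <= h 1%N + K * ((h i + h i.+1) / 2) by lra.
  apply: le_trans (ler_wpM2l C D) _; rewrite le_eqVlt; apply/orP; left; apply/eqP; ring.
rewrite big_split/= -!mulr_sumr E => H.
(* With [- q * h 1 * q ^+ N] dropped, the new sum is at most [(1 - q) / 2 * h 1 + q * h 1 + K * q *
   h 1]. By [Kq] the last term is at most [(1 - q) / 2 * h 1], and the total is [h 1]. *)
have qN : 0 <= q ^+ N by rewrite exprn_ge0// ltW.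
have := ler_wpM2l (mulr_ge0 K0 (ltW q0)) IH.
have := ler_wpM2r h1 Kq.
have : 0 <= q * h 1%N * q ^+ N by rewrite !mulr_ge0// ltW.
move: H; nra.
Qed.

(** The graph of [f] stays below its chord, whose integral is the trapezoid area. *)
Lemma ge0_integral_le_trapezoid (R : realType) (f : R -> R) (a b : R) :
  a < b -> measurable_fun `[a, b] f -> {in `[a, b], forall u, 0 <= f u} ->
  {in `[a, b], forall u, f u <= f a + (f b - f a) / (b - a) * (u - a)} ->
  (\int[lebesgue_measure]_(u in `[a, b[) (f u)%:E
   <= ((b - a) * ((f a + f b) / 2))%:E)%E.
Proof.
move=> ab mf f_ge0 f_le; rewrite integral_itv_bndo_bndc; last first.
  by apply/measurable_EFinP; apply/measurable_fun_itv_bndo_bndcP.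
have -> : (b - a) * ((f a + f b) / 2)
    = (b - a) * (f a + (f b - f a) / (b - a) * (b - a) / 2).
  by field; rewrite gt_eqF// subr_gt0.
rewrite -integral_affine//; apply: ge0_le_integral => //.
- exact/measurable_EFinP.
- apply/measurable_EFinP; apply: measurable_funD => //.
  by apply: measurable_funM => //; apply: measurable_funB.
Qed.

(** Induction on [N] glues the half-open piece from [x * q ^+ N.+1] to [x * q ^+ N] to the left of
    the interval, without overlap; its trapezoid bound is the new last summand. *)
Lemma ge0_integral_geometric_le (R : realType) (f : R -> R) (q x : R) (N : nat) :
  0 < q < 1 -> 0 < x -> measurable_fun `]0, x] f ->
  {in `]0, x], forall u, 0 <= f u} ->
  (forall a b u, 0 < a -> a < b -> b <= x -> a <= u <= b ->
    f u <= f a + (f b - f a) / (b - a) * (u - a)) ->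
  (\int[lebesgue_measure]_(u in `[(x * q ^+ N)%R, x[) (f u)%:E
   <= (x * \sum_(n < N) q ^+ n * (1 - q)
           * ((f (x * q ^+ n) + f (x * q ^+ n.+1)) / 2))%:E)%E.
Proof.
move=> /andP[q0 q1] x0 mf f_ge0 f_chord.
have a_gt0 n : 0 < x * q ^+ n by rewrite mulr_gt0// exprn_gt0.
have a_le n : x * q ^+ n <= x by rewrite ger_pMr// exprn_ile1// ltW.
have a_lt n : x * q ^+ n.+1 < x * q ^+ n.
  by rewrite ltr_pM2l// exprS gtr_pMl// exprn_gt0.
elim: N => [|N IH].
  by rewrite big_ord0 expr0 mulr1 mulr0 set_itvco0 integral_set0.
rewrite (@itv_bndbnd_setU _ _ _ (BLeft (x * q ^+ N))); last 2 first.
- by rewrite bnd_simp ltW.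
- by rewrite bnd_simp.
have sub_itv n : `[x * q ^+ n, x[%classic `<=` `]0, x]%classic.
  move=> u; rewrite /= !in_itv/= => /andP[xu /ltW ->].
  by rewrite (lt_le_trans (a_gt0 n)).
have sub_piece : `[x * q ^+ N.+1, x * q ^+ N]%classic `<=` `]0, x]%classic.
  move=> u; rewrite /= !in_itv/= => /andP[xu ux].
  by rewrite (lt_le_trans (a_gt0 N.+1))//= (le_trans ux).
have sub_union : `[x * q ^+ N.+1, x * q ^+ N[ `|` `[x * q ^+ N, x[
    `<=` `]0, x]%classic.
  by rewrite -itv_bndbnd_setU ?bnd_simp// ltW.
rewrite ge0_integral_setU//; first last.
- apply/disj_set2P/seteqP; split => u //= []; rewrite !in_itv/=.
  by move=> /andP[_ uN] /andP[]; rewrite leNgt uN.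
- by move=> u /sub_union u_in; rewrite lee_fin f_ge0.
- by apply/measurable_EFinP; apply: measurable_funS mf.
rewrite big_ord_recr/= mulrDr EFinD [leLHS]addeC; apply: (leeD IH).
have -> : x * (q ^+ N * (1 - q) * ((f (x * q ^+ N) + f (x * q ^+ N.+1)) / 2))
  = (x * q ^+ N - x * q ^+ N.+1) * ((f (x * q ^+ N.+1) + f (x * q ^+ N)) / 2).
  by rewrite exprS; field.
apply: ge0_integral_le_trapezoid => //.
- exact: measurable_funS mf.
- by move=> u /sub_piece; exact: f_ge0.
- by move=> u; rewrite in_itv/=; exact: f_chord.
Qed.

(** As [q ^+ n] tends to 0, the intervals [[x * q ^+ n, x[] increase to []0, x[], and monotone
    convergence carries the uniform bound to the limit. *)
Lemma ge0_integral_oo_le (R : realType) (f : R -> R) (q x B : R) :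
  0 < q < 1 -> 0 < x -> measurable_fun `]0, x] f ->
  {in `]0, x], forall u, 0 <= f u} ->
  (forall N, \int[lebesgue_measure]_(u in `[(x * q ^+ N)%R, x[) (f u)%:E
    <= B%:E)%E ->
  (\int[lebesgue_measure]_(u in `]0%R, x[) (f u)%:E <= B%:E)%E.
Proof.
move=> /andP[q0 q1] x0 mf f_ge0 f_le.
have a_gt0 n : 0 < x * q ^+ n by rewrite mulr_gt0// exprn_gt0.
have sub_itv n : `[x * q ^+ n, x[%classic `<=` `]0, x]%classic.
  move=> u; rewrite /= !in_itv/= => /andP[xu /ltW ->].
  by rewrite (lt_le_trans (a_gt0 n)).
have -> : `]0, x[%classic = \bigcup_n `[x * q ^+ n, x[%classic.
  apply/seteqP; split => [u|u [n _]]; rewrite /= !in_itv/= => /andP[u0 ux].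
    have u_x : 0 < u / x by rewrite divr_gt0.
    have q_lt1 : `|q| < 1 by rewrite gtr0_norm.
    have [n _ /(_ n (leqnn n)) qn] := cvgr_lt _ (cvg_expr q_lt1) _ u_x.
    by exists n => //=; rewrite in_itv/= ux andbT mulrC -ler_pdivlMr// ltW.
  by rewrite ux (lt_le_trans (a_gt0 n)).
have int_cvg := @ge0_nondecreasing_set_cvg_integral _ (measurableTypeR R) R
  (fun n => `[x * q ^+ n, x[%classic) (EFin \o f) lebesgue_measure.
apply: (cvge_le _ (int_cvg _ _ _ _)) => //; first exact: nearW.
- move=> n m nm; apply/subsetPset => u; rewrite /= !in_itv/= => /andP[xu ->].
  by rewrite (le_trans _ xu)// ler_pM2l// ler_wiXn2l// ltW.
- by move=> n; apply/measurable_EFinP; apply: measurable_funS mf.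
- by move=> n u /sub_itv u_in; rewrite lee_fin f_ge0.
Qed.

(** The analytic core, free of probability. Subtracting [G x] gives a nonnegative function, to which
    the geometric decomposition applies; the constant is restored at the end. *)
Lemma nonincreasing_convex_mean_le (R : realType) (G : R -> R) (q K x : R) :
  0 < q < 1 -> 0 <= K -> K * q <= (1 - q) / 2 -> 0 < x ->
  {in `]0, x] &, {homo G : u v /~ u <= v}} ->
  (forall a b u, 0 < a -> a < b -> b <= x -> a <= u <= b ->
    G u <= G a + (G b - G a) / (b - a) * (u - a)) ->
  {in `]0, x], forall u, G (q * u) - G (q * x) <= K * (G u - G x)} ->
  ((1 / x)%R%:E * \int[lebesgue_measure]_(u in `]0%R, x[) (G u)%:E
   <= (G (q * x)%R)%:E)%E.
Proof.
move=> q01 K0 Kq x0 G_ni G_chord G_scale; have /andP[q0 q1] := q01.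
have a_in n : x * q ^+ n \in `]0, x].
  by rewrite in_itv/= mulr_gt0 ?exprn_gt0//= ger_pMr// exprn_ile1// ltW.
have x_in : x \in `]0, x] by rewrite in_itv/= x0 lexx.
pose f u := G u - G x.
have mf : measurable_fun `]0, x] f.
  by apply: measurable_funB => //; exact: nonincreasing_in_itv_measurable.
have f_ge0 : {in `]0, x], forall u, 0 <= f u}.
  move=> u u_in; rewrite subr_ge0 G_ni//.
  by move: u_in; rewrite in_itv => /andP[].
have f_int : (\int[lebesgue_measure]_(u in `]0%R, x[) (f u)%:E
    <= (x * f (x * q))%:E)%E.
  apply: (ge0_integral_oo_le q01 x0 mf f_ge0) => N.
  apply: le_trans (ge0_integral_geometric_le N q01 x0 mf f_ge0 _) _.
    move=> a b u a0 ab bx aub; rewrite /f.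
    by have := G_chord a b u a0 ab bx aub; rewrite opprB addrA subrK; lra.
  rewrite lee_fin ler_pM2l//.
  rewrite -[in leRHS](expr1 q).
  apply: (@geometric_trapezoid_sum_le _ q K (fun n => f (x * q ^+ n))) => //.
  - by rewrite /f expr0 mulr1 subrr.
  - exact: f_ge0.
  (* Scaling at [u = x * q ^+ n] is the recursion for the increments. *)
  - move=> n; have := G_scale _ (a_in n).
    by rewrite /f expr1 exprS mulrCA (mulrC q x); lra.
(* As [f] is nonnegative, [f_int] also bounds the integral of its absolute value. Integrability
   allows the integral of [G], whose sign is not fixed, to be split into that of [f] and a
   constant. *)
have f_integrable : lebesgue_measure.-integrable `]0, x[ (EFin \o f).
  apply/integrableP; split.
    apply/measurable_EFinP; apply: measurable_funS mf => //.
    by apply: subset_itvl; rewrite bnd_simp.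
  apply: le_lt_trans (ltry (x * f (x * q))); apply: le_trans f_int.
  rewrite le_eqVlt; apply/predU1P; left; apply: eq_integral => u.
  rewrite inE/= in_itv/= => /andP[u0 /ltW ux].
  by rewrite ger0_norm// f_ge0// in_itv/= u0.
have mu_x : lebesgue_measure `]0, x[ = x%:E.
  by rewrite lebesgue_measure_itv/= lte_fin x0 sube0.
have c_integrable : lebesgue_measure.-integrable `]0, x[ (EFin \o cst (G x)).
  apply/integrableP; split; first exact/measurable_EFinP.
  by rewrite (eq_integral (cst `|G x|%:E))// integral_cst//= mu_x -EFinM ltry.
have -> : (\int[lebesgue_measure]_(u in `]0%R, x[) (G u)%:E
    = \int[lebesgue_measure]_(u in `]0%R, x[) (f u)%:E + (G x * x)%:E)%E.
  rewrite EFinM -mu_x -integral_cst// -integralD//.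
  by apply: eq_integral => u _; rewrite -EFinD /f subrK.
rewrite div1r lee_pdivrMl//.
apply: (le_trans (leeD2r _ f_int)).
by rewrite -EFinD -EFinM lee_fin /f (mulrC q); lra.
Qed.

Theorem proposition8 (R : realType) (d : measure_display)
    (Omega : measurableType d) (P : probability Omega R) (Y : {RV P >-> R})
    (p T r : R)
    (convex_quantile :
      convex_function (`]0, 1[%classic : set R) (quantile Y : R -> R))
    (p_gt1 : 1 < p) (T_ge1 : 1 <= T)
    (quantile_star_scaling : forall delta x y : R,
      0 < delta < 1 -> 0 < x < 1 -> 0 < y < 1 ->
      `|quantile_star Y (delta * x) - quantile_star Y (delta * y)|
        <= T * delta `^ (- (1 / p)) * `|quantile_star Y x - quantile_star Y y|)
    (r_gt1 : 1 < r) (T_le : T <= (r - 1) * r `^ (- (1 / p)) / 2) :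
  forall x : R, 0 < x < 1 ->
    ((1 / x)%R%:E * \int[lebesgue_measure]_(u in `]0%R, x[) (quantile_star Y u)%:E
       <= (quantile_star Y (x / r)%R)%:E)%E.
Proof.
move=> x /andP[x0 x1].
have r0 : 0 < r by rewrite (lt_trans ltr01).
have q01 : 0 < r^-1 < 1 by rewrite invr_gt0 r0 invf_lt1.
have G_ni : {in `]0, x] &, {homo quantile_star Y : u v /~ u <= v}}.
  move=> u v; rewrite !in_itv/= => /andP[u0 ux] /andP[v0 vx] uv.
  by apply: quantile_nondecreasing; lra.
rewrite (mulrC x).
apply: (@nonincreasing_convex_mean_le R _ r^-1 (T * r^-1 `^ (- (1 / p)))) => //.
- by rewrite mulr_ge0 ?powR_ge0// (le_trans ler01).
(* Once the factor 1/r is cleared, the claim is [T_le] multiplied by r^(1/p). *)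
- have s0 : 0 < r `^ (1 / p) by rewrite powR_gt0.
  have -> : r^-1 `^ (- (1 / p)) = r `^ (1 / p).
    by rewrite -powR_inv1 ?ltW// -powRrM mulN1r opprK.
  have -> : (1 - r^-1) / 2 = (r - 1) / 2 / r by field; rewrite gt_eqF.
  rewrite ler_pM2r ?invr_gt0//.
  have := ler_wpM2r (ltW s0) T_le; rewrite powRN.
  rewrite [X in _ <= X -> _](_ : _ = (r - 1) / 2)//.
  by field; rewrite gt_eqF.
- move=> a b u a0 ab bx /andP[au ub].
  (* Reflection by 1 - u turns the chord over [[a, b]] into the chord of [quantile Y] over
     [[1 - b, 1 - a]], with endpoints swapped. *)
  have := @convex_function_chord _ _ _ (1 - b) (1 - a) (1 - u) convex_quantile.
  rewrite /= !in_itv/= => chord.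
  have {}chord : quantile Y (1 - u) <= quantile Y (1 - b)
      + (quantile Y (1 - a) - quantile Y (1 - b)) / (1 - a - (1 - b))
        * (1 - u - (1 - b)).
    by apply: chord; lra.
  apply: le_trans chord _; rewrite /quantile_star le_eqVlt; apply/predU1P; left.
  by field; rewrite !gt_eqF//; lra.
- move=> u; rewrite in_itv/= => /andP[u0 ux].
  have u1 : 0 < u < 1 by lra.
  (* Scaling with delta = 1/r and y = x. Monotonicity removes the absolute value on the right; the
     one on the left dominates the signed difference. *)
  have := quantile_star_scaling r^-1 u x q01 u1 (introT andP (conj x0 x1)).
  rewrite [X in _ <= _ * X -> _]ger0_norm ?subr_ge0.
    exact: le_trans (ler_norm _).
  by rewrite G_ni// in_itv/= ?u0 ?x0 ?ux ?lexx.
Qed.
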